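(* Let $Y\subset\mathbb{P}^5$ be a cubic fourfold of type U6. Then $Y$ contains a singular point of corank at least $4$. Conversely, if $Y$ contains a singular point of corank $4$ or more, then $Y$ is of type U6. In particular, a cone over a cubic threefold is unstable.
   Context: We work over $\mathbb{C}$. A cubic fourfold is a hypersurface in $\mathbb{P}^5$ given by a nonzero cubic form in $x_0,\dots,x_5$. It is of type U6 if in suitable linear coordinates its equation is a linear combination of cubic monomials $x_0^{i_0}\cdots x_5^{i_5}$ of weight $\sum i_ja_j<0$, where $(a_0,\dots,a_5)=(11,-1,-1,-1,-1,-7)$. Unstable means not semistable in the GIT sense for $\mathrm{SL}(6)$ acting on $\mathbb{P}(\mathrm{Sym}^3W)$, $W=H^0(\mathbb{P}^5,\mathcal{O}(1))$. The corank of a hypersurface singularity $f(y_1,\dots,y_n)=0$ at the origin is $n$ minus the rank of the Hessian of $f$ at the origin (here $n=5$). *)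

(* Defs.v *)
From HB Require Import structures.
From mathcomp Require Import all_boot all_order all_algebra.
From mathcomp Require Import reals.
From mathcomp Require Import complex mpoly.

Set Implicit Arguments.
Unset Strict Implicit.
Unset Printing Implicit Defensive.

Import Order.TTheory GRing.Theory Num.Theory.
Local Open Scope ring_scope.

Section Forms.
Variable K : fieldType.

(* A hypersurface of P^n is represented by an equation. *)
Definition cubic_hypersurface (n : nat) (F : {mpoly K[n.+1]}) : Prop :=
  F \is 3.-homog /\ F != 0.

Definition cubic_fourfold (F : {mpoly K[6]}) : Prop :=
  @cubic_hypersurface 5 F.

Definition cubic_threefold (F : {mpoly K[5]}) : Prop :=
  @cubic_hypersurface 4 F.

(* F (A x) : substitute \sum_j A i j x_j for x_i. *)
Definition lin_subst (n : nat) (A : 'M[K]_n) (F : {mpoly K[n]}) :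
    {mpoly K[n]} :=
  F \mPo [tuple \sum_(j < n) A i j *: 'X_j | i < n].

Definition U6_weights : seq int := [:: 11; -1; -1; -1; -1; -7].

Definition mweight6 (a : seq int) (m : 'X_{1..6}) : int :=
  \sum_(j < 6) (m j)%:Z * a`_j.

Definition type_U6 (F : {mpoly K[6]}) : Prop :=
  exists2 A : 'M[K]_6, A \in unitmx &
    {in msupp (lin_subst A F), forall m, mweight6 U6_weights m < 0}.

Section Corank.
Variables (n : nat) (f : {mpoly K[n]}).

Definition singular_at_origin : Prop :=
  f.@[fun=> 0] = 0 /\ forall i, (f^`M(i)).@[fun=> 0] = 0.

Definition hessian_at_origin : 'M[K]_n :=
  \matrix_(i, j) ((f^`M(i))^`M(j)).@[fun=> 0].

Definition corank_at_origin : nat := (n - \rank hessian_at_origin)%N.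
End Corank.

(* Equation of the hypersurface F = 0 in the chart x_i = 1, with affine
   coordinates y translated so that [p] becomes the origin. *)
Definition affine_equation (n : nat) (F : {mpoly K[n.+1]}) (p : 'rV[K]_n.+1)
    (i : 'I_n.+1) : {mpoly K[n]} :=
  F \mPo [tuple if unlift i k is Some j then 'X_j + (p 0 k / p 0 i)%:MP else 1
         | k < n.+1].

(* For p != 0 this is a standard chart around [p]; which one is chosen does not
   affect singularity or corank.  The default ord0 is only reached at p = 0. *)
Definition chart_at (n : nat) (p : 'rV[K]_n.+1) : 'I_n.+1 :=
  odflt ord0 [pick i | p 0 i != 0].

Definition local_equation (n : nat) (F : {mpoly K[n.+1]}) (p : 'rV[K]_n.+1) :
    {mpoly K[n]} :=
  affine_equation F p (chart_at p).

(* Points of P^n are nonzero vectors up to scaling. *)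
Definition singular_point (n : nat) (F : {mpoly K[n.+1]}) (p : 'rV[K]_n.+1) :
    Prop :=
  p != 0 /\ singular_at_origin (local_equation F p).

Definition point_corank (n : nat) (F : {mpoly K[n.+1]}) (p : 'rV[K]_n.+1) :
    nat :=
  corank_at_origin (local_equation F p).

(* In suitable coordinates, the equation is that of a cubic threefold in the
   variables x_1, ..., x_5; the vertex is then [1 : 0 : ... : 0]. *)
Definition cone_over_cubic_threefold (F : {mpoly K[6]}) : Prop :=
  exists2 A : 'M[K]_6, A \in unitmx &
    exists2 G : {mpoly K[5]}, cubic_threefold G &
      lin_subst A F = G \mPo [tuple 'X_(lift ord0 j) | j < 5].

(* Monomial basis of Sym^3 W, giving the coordinates of a cubic form. *)
Definition cubic_monomials : {set 'X_{1..6 < 4}} :=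
  [set m : 'X_{1..6 < 4} | mdeg m == 3%N].

Definition cubic_coords (F : {mpoly K[6]}) : 'I_#|cubic_monomials| -> K :=
  fun k => F@_(enum_val k).

(* Polynomial functions on Sym^3 W, homogeneous of degree d, i.e. sections of
   O(d) on P(Sym^3 W), that are invariant under SL(6).  Using F (A x) instead of
   F (A^-1 x) does not change the invariants. *)
Definition SL6_invariant (d : nat) (P : {mpoly K[#|cubic_monomials|]}) : Prop :=
  P \is d.-homog /\
  forall (A : 'M[K]_6) (F : {mpoly K[6]}), \det A = 1 -> F \is 3.-homog ->
    P.@[cubic_coords (lin_subst A F)] = P.@[cubic_coords F].

Definition semistable (F : {mpoly K[6]}) : Prop :=
  exists (d : nat) (P : {mpoly K[#|cubic_monomials|]}),
    [/\ (0 < d)%N, SL6_invariant d P & P.@[cubic_coords F] != 0].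

Definition unstable (F : {mpoly K[6]}) : Prop := ~ semistable F.

End Forms.

(* Main.v *)
Require Import Defs.
From mathcomp Require Import all_boot all_order all_fingroup all_algebra.
From mathcomp Require Import reals.
From mathcomp Require Import complex mpoly.
From mathcomp Require Import ring zify.

(** Let [H p] be the Hessian matrix of the cubic form [F] at the vector [p].
    Since the second derivatives of [F] are linear, the coefficient of
    [x_0 x_j x_k] in [F] is a nonzero multiple of the [(j, k)] entry of
    [H e_0]; the only such monomial of negative weight is [x_0 x_5^2], and all
    cubic monomials without [x_0] have negative weight.  So [F] is of type U6
    iff [A^T H(A e_0) A] is supported on the entry [(5, 5)] for some invertible
    [A].  On the other hand, by Euler's identities, [p] is singular iff
    [H p] annihilates [p], and the Hessian of a local equation at [p] is a
    principal minor of [H p] of the same rank; so [p] has corank at least 4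
    iff moreover [H p] has rank at most 1.  A symmetric matrix of rank at most
    1 which annihilates [p] has the required normal form in a basis starting
    with [p].

    For a cone over [G(x_1, ..., x_5)], the substitution
    [diag(2^-5, 2, ..., 2)] has determinant 1 and multiplies [G] by 8, so that
    every invariant of positive degree vanishes on it. *)

Set Implicit Arguments.
Unset Strict Implicit.
Unset Printing Implicit Defensive.

Import Order.TTheory GRing.Theory Num.Theory.
Local Open Scope ring_scope.

Section Polynomials.
Variable K : fieldType.

Lemma mpoly_ring_ind (n : nat) (P : {mpoly K[n]} -> Prop) :
  P 1 -> (forall i, P 'X_i) -> (forall p q, P p -> P q -> P (p + q)) ->
  (forall p q, P p -> P q -> P (p * q)) -> (forall c p, P p -> P (c *: p)) ->
  forall p, P p.
Proof.
move=> P1 PX PD PM PZ p; elim/mpolyind: p => [|c m p _ _ Pp].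
  by rewrite -(scale0r 1); apply: PZ.
apply: PD => //; apply: PZ; rewrite mpolyXE_id.
apply: big_ind => // i _; elim: (m i) => [|k IHk]; first by rewrite expr0.
by rewrite exprS; apply: PM.
Qed.

Lemma mderivXU (n : nat) (i j : 'I_n) :
  ('X_i : {mpoly K[n]})^`M(j) = (i == j)%:R.
Proof.
rewrite mderivX mnm1E; case: eqVneq => [->|_]; last by rewrite scale0r.
by have := addmK U_(j) 0%MM; rewrite add0m => ->; rewrite mpolyX0 scale1r.
Qed.

Lemma mderiv_comp (n k : nat) (lq : n.-tuple {mpoly K[k]}) (p : {mpoly K[n]})
    (j : 'I_k) :
  (p \mPo lq)^`M(j) = \sum_(i < n) (p^`M(i) \mPo lq) * (tnth lq i)^`M(j).
Proof.
elim/mpoly_ring_ind: p => [|i|p q IHp IHq|p q IHp IHq|c p IHp].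
- rewrite rmorph1 -[1]/(1%:MP) mderivC big1 // => i _.
  by rewrite mderivC comp_mpoly0 mul0r.
- rewrite comp_mpolyXU -tnth_nth (bigD1 i) //= big1 => [|l ne_li].
    by rewrite mderivXU eqxx comp_mpoly1 mul1r addr0.
  by rewrite mderivXU eq_sym (negbTE ne_li) comp_mpoly0 mul0r.
- rewrite comp_mpolyD mderivD IHp IHq -big_split; apply: eq_bigr => i _ /=.
  by rewrite mderivD comp_mpolyD mulrDl.
- rewrite rmorphM /= mderivM IHp IHq mulr_suml mulr_sumr -big_split.
  by apply: eq_bigr => i _ /=; rewrite mderivM rmorphD !rmorphM /=; ring.
- rewrite comp_mpolyZ mderivZ IHp scaler_sumr; apply: eq_bigr => i _.
  by rewrite mderivZ comp_mpolyZ scalerAl.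
Qed.

Lemma comp_mpolyA (n k l : nat) (lq : n.-tuple {mpoly K[k]})
    (lr : k.-tuple {mpoly K[l]}) (p : {mpoly K[n]}) :
  (p \mPo lq) \mPo lr = p \mPo [tuple tnth lq i \mPo lr | i < n].
Proof.
elim/mpoly_ring_ind: p => [|i|p q IHp IHq|p q IHp IHq|c p IHp].
- by rewrite !rmorph1.
- by rewrite !comp_mpolyXU -!tnth_nth tnth_mktuple.
- by rewrite !comp_mpolyD IHp IHq.
- by rewrite !rmorphM /= IHp IHq.
- by rewrite !comp_mpolyZ IHp.
Qed.

Lemma dhomog_mderiv (n d : nat) (p : {mpoly K[n]}) (i : 'I_n) :
  p \is d.+1.-homog -> p^`M(i) \is d.-homog.
Proof.
move=> /dhomogP hp; apply/dhomogP => m; rewrite mcoeff_msupp mcoeff_deriv => nz.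
have /hp : (m + U_(i))%MM \in msupp p.
  by rewrite mcoeff_msupp; apply: contraNneq nz => ->; rewrite mul0rn.
by rewrite /= mdegD mdeg1 addn1 => -[].
Qed.

Lemma dhomog_comp (n k d e : nat) (lq : n.-tuple {mpoly K[k]})
    (p : {mpoly K[n]}) :
  p \is d.-homog -> (forall i, tnth lq i \is e.-homog) ->
  p \mPo lq \is (e * d).-homog.
Proof.
move=> hp hq; rewrite comp_mpolyEX big_seq; apply: rpred_sum => m m_p.
rewrite dhomogZ // comp_mpolyX -(dhomog_mf hp m_p) /= mdegE big_distrr /=.
elim/big_rec2: _ => [|i x y _ hy]; first exact: dhomog1.
by apply: dhomogM => //; apply: dhomogMn.
Qed.

Lemma dhomog_mevalZ (n d : nat) (p : {mpoly K[n]}) (c : K) (v : 'I_n -> K) :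
  p \is d.-homog -> p.@[fun i => c * v i] = c ^+ d * p.@[v].
Proof.
move=> hp; rewrite !mevalE mulr_sumr; apply: eq_big_seq => m m_p.
rewrite mulrCA; congr (_ * _); rewrite -(dhomog_mf hp m_p) /= mdegE.
rewrite -prodrXr -big_split; apply: eq_bigr => i _ /=.
by rewrite exprMn.
Qed.

Lemma euler_dhomog (n d : nat) (p : {mpoly K[n]}) : p \is d.-homog ->
  \sum_(i < n) 'X_i * p^`M(i) = d%:R *: p.
Proof.
move=> hp; transitivity (\sum_(m <- msupp p) d%:R *: (p@_m *: 'X_[m])); last first.
  by rewrite -scaler_sumr -mpolyE.
rewrite {1}[p]mpolyE.
under eq_bigr do rewrite raddf_sum mulr_sumr.
rewrite exchange_big; apply: eq_big_seq => m m_p /=.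
rewrite -(dhomog_mf hp m_p) /= mdegE natr_sum scaler_suml.
apply: eq_bigr => i _; rewrite mderivZ mderivX -!scalerAr -mpolyXD scalerA.
rewrite scalerA mulrC; case: (posnP (m i)) => [->|mi_gt0].
  by rewrite !mul0r !scale0r.
congr (_ *: 'X_[_]); apply/mnmP => j; rewrite mnmDE mnmBE mnm1E.
by case: eqP => [<-|_]; lia.
Qed.

Lemma meval_delta (n d : nat) (p : {mpoly K[n]}) (i : 'I_n) :
  p \is d.-homog -> p.@[fun j => (j == i)%:R] = p@_(U_(i) *+ d).
Proof.
move=> hp; rewrite [in RHS](mpolyE p) mevalE raddf_sum; apply: eq_big_seq => m m_p.
rewrite /= mcoeffZ mcoeffX; congr (_ * _); rewrite -(dhomog_mf hp m_p) /=.
have [->|ne] := eqVneq m _.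
  rewrite big1 // => j _; rewrite mulmnE mnm1E [in _ ^+ _]eq_sym.
  by case: eqP; rewrite ?expr1n // mul0n expr0.
have [j ne_ji mj] : exists2 j, j != i & m j != 0%N.
  apply/exists_inP; apply: contraNT ne => /exists_inPn m0; apply/eqP/mnmP => j.
  have mj0 k : k != i -> m k = 0%N by move=> /m0; rewrite negbK => /eqP.
  rewrite mulmnE mnm1E mdegE (bigD1 i) //= big1 // addn0 eq_sym.
  by case: eqVneq => [->|/mj0]; rewrite ?mul1n.
by rewrite (bigD1 j) //= (negbTE ne_ji) expr0n (negbTE mj) mul0r.
Qed.

End Polynomials.

Section LinearAlgebra.
Variable K : fieldType.

Lemma mxrank_row' (m n : nat) (N : 'M[K]_(m.+1, n)) (q : 'rV_m.+1) i :
  q *m N = 0 -> q 0 i != 0 -> \rank (row' i N) = \rank N.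
Proof.
move=> qN0 qi; apply/eqP; rewrite eqn_leq !mxrankS //; last first.
  by apply/row_subP => k; rewrite row_rowsub row_sub.
have lift_sub k : (row (lift i k) N <= row' i N)%MS.
  by rewrite -row_rowsub row_sub.
apply/row_subP => j; case: (unliftP i j) => [k ->|->] //.
move: qN0; rewrite mulmx_sum_row (bigD1 i) //= => /eqP.
rewrite addr_eq0 => /eqP qi_row.
rewrite -(eqmx_scale _ qi) qi_row eqmx_opp; apply: summx_sub => k.
by case: (unliftP i k) => [l ->|->]; rewrite ?eqxx // => _; apply: scalemx_sub.
Qed.

Lemma mxrank_sym_minor (n : nat) (H : 'M[K]_n.+1) (q : 'rV_n.+1) i :
  H^T = H -> q *m H = 0 -> q 0 i != 0 ->
  \rank (mxsub (lift i) (lift i) H) = \rank H.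
Proof.
move=> Hsym qH0 qi; rewrite -(mxrank_row' qH0 qi) -[RHS]mxrank_tr.
rewrite -(@mxrank_row' _ _ (row' i H)^T q i) //.
  by rewrite -mxrank_tr; congr (\rank _); apply/matrixP => k l; rewrite !mxE.
apply/rowP => k; transitivity ((q *m H) 0 (lift i k)); last by rewrite qH0 !mxE.
by rewrite -{2}Hsym !mxE; apply: eq_bigr => l _; rewrite !mxE.
Qed.

Lemma unitmx_row_exists (n : nat) (v : 'rV[K]_n.+1) (i : 'I_n.+1) :
  v != 0 -> exists2 M : 'M_n.+1, M \in unitmx & row i M = v.
Proof.
move=> v_neq0.
have rv : \rank v = 1%N by rewrite rank_rV v_neq0.
have := mulmx_ebase v; rewrite rv [col_ebase v]mx11_scalar.
set c := col_ebase v 0 0 => def_v.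
have c_neq0 : c != 0.
  by apply: contraNneq v_neq0 => c0; rewrite -def_v c0 raddf0 !mul0mx.
exists (tperm_mx 0 i *m (c *: row_ebase v)).
  rewrite unitmx_mul unitmx_perm /= -mul_scalar_mx unitmx_mul row_ebase_unit.
  by rewrite andbT unitmxE det_scalar unitfE expf_neq0.
rewrite -xrowE; apply/rowP => j; rewrite !mxE tpermR -[v in RHS]def_v.
rewrite -mulmxA mul_scalar_mx !mxE (bigD1 ord0) //= big1 => [|k ne_k0].
  by rewrite !mxE mul1r addr0.
have /negbTE k0 : (0 != k :> nat)%N by rewrite eq_sym.
  by rewrite mxE /= k0 mul0r.
Qed.

Lemma adapted_basis (n : nat) (q w : 'rV[K]_n.+2) :
  q != 0 -> w != 0 -> w *m q^T = 0 ->
  exists2 A : 'M_n.+2, A \in unitmx &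
    row 0 A^T = q /\ w *m A = delta_mx 0 ord_max.
Proof.
move=> q0 w0 wq0; have [M Mu Mq] := unitmx_row_exists 0 q0.
pose v : 'rV_(1 + n.+1) := w *m M^T.
have v0 : lsubmx v = 0.
  rewrite -wq0 -Mq; apply/rowP => j; rewrite ord1 !mxE.
  by apply: eq_bigr => k _; rewrite !mxE; congr (_ * M _ _); apply: val_inj.
have v'0 : rsubmx v != 0.
  apply: contraNneq w0 => v'0; have : v = 0 by rewrite -[v]hsubmxK v0 v'0 row_mx0.
  by move/eqP; rewrite mulmx_free_eq0 // row_free_unit unitmx_tr.
have [N Nu Nv] := unitmx_row_exists ord_max v'0.
pose B : 'M_(1 + n.+1) := block_mx 1%:M 0 0 (invmx N).
have Bu : B \in unitmx.
  by rewrite unitmxE det_lblock det1 mul1r -unitmxE unitmx_inv.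
exists (M^T *m B).
  by rewrite unitmx_mul unitmx_tr Mu.
split.
  rewrite trmx_mul trmxK row_mul -Mq [RHS]rowE; congr (_ *m M).
  apply/rowP => j; rewrite 3!mxE; case: splitP => k /= jk.
    rewrite mxE; case: splitP => // l _; rewrite !mxE -!val_eqE /= jk !ord1.
    by rewrite eqxx.
  by rewrite mxE; case: splitP => // l _; rewrite !mxE -!val_eqE /= jk.

have vB : v *m B = row_mx 0 'e_ord_max.
  rewrite -[v]hsubmxK v0 mul_row_block !mul0mx mulmx0 !add0r.
  by rewrite -Nv rowE mulmxK.
rewrite mulmxA -[LHS]/(v *m B) vB; apply/rowP => j; rewrite mxE.
case: splitP => k jk; first by rewrite !mxE -!val_eqE /= jk ord1.
by rewrite !mxE -!val_eqE /= jk add1n eqSS.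
Qed.

Lemma sym_rank1_normal_form (n : nat) (H : 'M[K]_n.+2) (q : 'rV_n.+2) :
  H^T = H -> (\rank H <= 1)%N -> q != 0 -> q *m H = 0 ->
  exists2 A : 'M_n.+2, A \in unitmx &
    row 0 A^T = q /\ exists c, A^T *m H *m A = c *: delta_mx ord_max ord_max.
Proof.
move=> Hsym rH q0 qH0; have [H0|] := eqVneq H 0.
  have [M Mu Mq] := unitmx_row_exists 0 q0; exists M^T; first by rewrite unitmx_tr.
  by rewrite trmxK; split=> //; exists 0; rewrite H0 mulmx0 mul0mx scale0r.
move=> H_neq0; have [i w0] : exists i, row i H != 0.
  apply/existsP; apply: contraNT H_neq0 => /existsPn H0.
  by apply/eqP/row_matrixP => i; rewrite row0; apply/eqP; rewrite -[_ == _]negbK H0.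
have [D def_H] : exists D, H = D *m row i H.
  apply/submxP; rewrite -(mxrank_leqif_sup (row_sub i H)) eqn_leq.
  by rewrite mxrankS ?row_sub //= rank_rV w0.
have wq0 : row i H *m q^T = 0.
  by rewrite -row_mul -[H]Hsym -trmx_mul qH0 trmx0 row0.
have [A Au [Aq Aw]] := adapted_basis q0 w0 wq0.
exists A => //; split=> //; set S := A^T *m H *m A; exists (S ord_max ord_max).
have Ssym : S^T = S by rewrite !trmx_mul trmxK Hsym mulmxA.
have S0 k l : l != ord_max -> S k l = 0.
  move=> /negbTE ne_l; rewrite /S def_H mulmxA -mulmxA Aw !mxE big_ord1 !mxE.
  by rewrite ne_l mulr0.
apply/matrixP => k l; rewrite [RHS]mxE [delta_mx _ _ _ _]mxE.
have [->|ne_l] := eqVneq l ord_max; last by rewrite S0 // andbF mulr0.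
have [->|ne_k] := eqVneq k ord_max; first by rewrite mulr1.
by rewrite -Ssym mxE S0 // mulr0.
Qed.

End LinearAlgebra.

Section Hessian.
Variable K : numFieldType.

Definition hess (n : nat) (F : {mpoly K[n]}) (x : 'rV[K]_n) : 'M[K]_n :=
  \matrix_(i, j) ((F^`M(i))^`M(j)).@[x 0].

Lemma hess_sym (n : nat) (F : {mpoly K[n]}) x : (hess F x)^T = hess F x.
Proof. by apply/matrixP => i j; rewrite !mxE mderiv_comm. Qed.

Lemma dhomog_meval_scale (n d : nat) (F : {mpoly K[n]}) c (x : 'rV_n) :
  F \is d.-homog -> F.@[(c *: x) 0] = c ^+ d * F.@[x 0].
Proof.
by move=> hF; rewrite -(dhomog_mevalZ _ _ hF); apply: meval_eq => i; rewrite mxE.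
Qed.

Lemma hess_cubicZ (n : nat) (F : {mpoly K[n]}) c x :
  F \is 3.-homog -> hess F (c *: x) = c *: hess F x.
Proof.
move=> hF; apply/matrixP => i j; rewrite !mxE (@dhomog_meval_scale _ 1) //.
by do 2!apply: dhomog_mderiv.
Qed.

Lemma euler_meval (n d : nat) (F : {mpoly K[n]}) (x : 'I_n -> K) :
  F \is d.-homog -> \sum_i x i * (F^`M(i)).@[x] = d%:R * F.@[x].
Proof.
move=> /euler_dhomog /(congr1 (meval x)); rewrite mevalZ => <-.
by rewrite raddf_sum; apply: eq_bigr => i _ /=; rewrite mevalM mevalXU.
Qed.

Lemma mulmx_hess_cubic (n : nat) (F : {mpoly K[n]}) x j :
  F \is 3.-homog -> (x *m hess F x) 0 j = 2 * (F^`M(j)).@[x 0].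
Proof.
move=> hF; rewrite mxE -(@euler_meval _ 2) ?dhomog_mderiv //.
by apply: eq_bigr => i _; rewrite mxE mderiv_comm.
Qed.

Lemma meval_lin_subst (n : nat) (A : 'M[K]_n) (F : {mpoly K[n]}) (x : 'rV_n) :
  (lin_subst A F).@[x 0] = F.@[(x *m A^T) 0].
Proof.
rewrite comp_mpoly_meval; apply: meval_eq => i.
rewrite tnth_mktuple raddf_sum mxE; apply: eq_bigr => j _ /=.
by rewrite mevalZ mevalXU mxE mulrC.
Qed.

Lemma mderiv_lin_subst (n : nat) (A : 'M[K]_n) (F : {mpoly K[n]}) j :
  (lin_subst A F)^`M(j) = \sum_i A i j *: lin_subst A (F^`M(i)).
Proof.
rewrite mderiv_comp; apply: eq_bigr => i _.
rewrite tnth_mktuple -[X in X * _]/(lin_subst A F^`M(i)).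
rewrite (raddf_sum (mderiv j)) (bigD1 j) //= big1 => [|k ne_kj].
  by rewrite mderivZ mderivXU eqxx addr0 -scalerAr mulr1.
by rewrite mderivZ mderivXU (negbTE ne_kj) scaler0.
Qed.

Lemma hess_lin_subst (n : nat) (A : 'M[K]_n) (F : {mpoly K[n]}) x :
  hess (lin_subst A F) x = A^T *m hess F (x *m A^T) *m A.
Proof.
apply/matrixP => i j; rewrite -mulmxA [LHS]mxE mderiv_lin_subst.
rewrite (raddf_sum (mderiv j)) raddf_sum mxE.
apply: eq_bigr => k _; rewrite /= mderivZ mevalZ mderiv_lin_subst raddf_sum !mxE.
congr (_ * _); apply: eq_bigr => l _.
by rewrite /= mevalZ meval_lin_subst mxE mulrC.
Qed.

Lemma lin_subst_homog (n d : nat) (A : 'M[K]_n) (F : {mpoly K[n]}) :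
  F \is d.-homog -> lin_subst A F \is d.-homog.
Proof.
move=> hF; rewrite -[d]mul1n; apply: dhomog_comp => // i; rewrite tnth_mktuple.
by apply: rpred_sum => j _; rewrite dhomogZ // dhomogX /= mdeg1.
Qed.

End Hessian.

Section Weights.
Variable K : numFieldType.

Lemma mweight6D a m1 m2 : mweight6 a (m1 + m2) = mweight6 a m1 + mweight6 a m2.
Proof.
rewrite /mweight6 -big_split; apply: eq_bigr => i _ /=.
by rewrite mnmDE PoszD mulrDl.
Qed.

Lemma mweight6U a i : mweight6 a U_(i) = a`_i.
Proof.
rewrite /mweight6 (bigD1 i) //= big1 => [|j /negbTE ne_ji].
  by rewrite mnm1E eqxx mul1r addr0.
by rewrite mnm1E eq_sym ne_ji mul0r.
Qed.

Lemma mnm_extract (n : nat) (m : 'X_{1..n}) i :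
  m i != 0%N -> exists m', m = (U_(i) + m')%MM.
Proof.
by rewrite -lep1mP => le_im; exists (m - U_(i))%MM; rewrite addmC submK.
Qed.

Lemma mnm_neq0 (n : nat) (m : 'X_{1..n}) : mdeg m != 0%N -> exists i, m i != 0%N.
Proof.
rewrite mdeg_eq0 => m0; apply/existsP; apply: contraNT m0 => /existsPn m0.
by apply/eqP/mnmP => i; rewrite mnm0E; apply/eqP; rewrite -[_ == _]negbK m0.
Qed.

Lemma hess_delta (n : nat) (F : {mpoly K[n]}) (o i j : 'I_n) :
  F \is 3.-homog -> (hess F (delta_mx 0 o) i j == 0)
    = (F@_(U_(o) + (U_(i) + U_(j))) == 0).
Proof.
move=> hF; rewrite mxE.
have -> : ((F^`M(i))^`M(j)).@[(delta_mx 0 o : 'rV_n) 0]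
        = ((F^`M(i))^`M(j)).@[fun k => (k == o)%:R].
  by apply: meval_eq => k; rewrite mxE.
rewrite (@meval_delta _ _ 1) ?dhomog_mderiv // mulm1n !mcoeff_deriv.
by rewrite !mulrn_eq0 /= -addmA [(U_(j) + _)%MM]addmC.
Qed.

Lemma U6_weights_hess (F : {mpoly K[6]}) : F \is 3.-homog ->
  {in msupp F, forall m, mweight6 U6_weights m < 0} <->
  exists c, hess F (delta_mx 0 0) = c *: delta_mx ord_max ord_max.
Proof.
move=> hF; split=> [neg|[c def_H] m m_F].
  exists (hess F (delta_mx 0 0) ord_max ord_max); apply/matrixP => i j.
  rewrite [RHS]mxE [delta_mx _ _ i j]mxE.
  case: (altP andP) => [[/eqP -> /eqP ->]|ne_ij]; first by rewrite mulr1.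
  rewrite mulr0; apply/eqP; rewrite hess_delta //; apply: contraNT ne_ij.
  rewrite -mcoeff_msupp => /neg; rewrite !mweight6D !mweight6U.
  by case: i => -[|[|[|[|[|[|]]]]]] //= ?; case: j => -[|[|[|[|[|[|]]]]]].
have mdeg_m : mdeg m = 3%N by apply: (dhomog_mf hF).
have [m0|/mnm_extract[m1 def_m]] := eqVneq (m 0) 0%N.
  move: mdeg_m; rewrite mdegE /mweight6 !big_ord_recl !big_ord0 /= m0.
  by rewrite /bump /=; lia.
have deg_m1 : mdeg m1 = 2%N by move: mdeg_m; rewrite def_m mdegD mdeg1; lia.
have [i /mnm_extract[m2 def_m1]] : exists i, m1 i != 0%N.
  by apply: mnm_neq0; rewrite deg_m1.
have /mdeg1P[j /eqP def_m2] : mdeg m2 == 1%N.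
  by apply/eqP; move: deg_m1; rewrite def_m1 mdegD mdeg1; lia.
move: m_F; rewrite def_m def_m1 def_m2 mcoeff_msupp -hess_delta // def_H !mxE.
case: (altP andP) => [[/eqP -> /eqP ->] _|_]; last by rewrite mulr0 eqxx.
by rewrite !mweight6D !mweight6U.
Qed.

Lemma type_U6P (F : {mpoly K[6]}) : F \is 3.-homog ->
  type_U6 F <-> exists2 A : 'M_6, A \in unitmx &
    exists c, A^T *m hess F (row 0 A^T) *m A = c *: delta_mx ord_max ord_max.
Proof.
move=> hF; split=> [[A Au /U6_weights_hess]|[A Au]].
  by rewrite hess_lin_subst -rowE => H; exists A => //; apply/H/lin_subst_homog.
rewrite rowE -hess_lin_subst => H; exists A => //; apply/U6_weights_hess => //.
exact: lin_subst_homog.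
Qed.

End Weights.

Section LocalEquation.
Variables (K : numFieldType) (n : nat).
Implicit Types (F : {mpoly K[n.+1]}) (p : 'rV[K]_n.+1).

Lemma meval_affine_equation F p i : p 0 i != 0 ->
  (affine_equation F p i).@[fun=> 0] = F.@[((p 0 i)^-1 *: p) 0].
Proof.
move=> pi; rewrite comp_mpoly_meval; apply: meval_eq => k.
rewrite tnth_mktuple mxE; case: unliftP => [j ->|->].
  by rewrite mevalD mevalXU mevalC add0r mulrC.
by rewrite meval1 mulVf.
Qed.

Lemma mderiv_affine_equation F p i j :
  (affine_equation F p i)^`M(j) = affine_equation (F^`M(lift i j)) p i.
Proof.
rewrite mderiv_comp (bigD1 (lift i j)) //= big1 => [|k ne_k].
  by rewrite tnth_mktuple liftK mderivD mderivC mderivXU eqxx !addr0 mulr1n mulr1.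
rewrite tnth_mktuple; case: unliftP ne_k => [l ->|_] ne_k.
  rewrite mderivD mderivC mderivXU addr0 (inj_eq lift_inj) in ne_k *.
  by rewrite (negbTE ne_k) mulr0.
by rewrite -[1]/(1%:MP) mderivC mulr0.
Qed.

Lemma hessian_affine_equation F p i : p 0 i != 0 ->
  hessian_at_origin (affine_equation F p i)
  = mxsub (lift i) (lift i) (hess F ((p 0 i)^-1 *: p)).
Proof.
move=> pi; apply/matrixP => j k.
by rewrite !mxE !mderiv_affine_equation meval_affine_equation.
Qed.

Lemma chart_at_neq0 p : p != 0 -> p 0 (chart_at p) != 0.
Proof.
rewrite /chart_at; case: pickP => [i //|p0 /eqP[]].
by apply/rowP => i; rewrite mxE; apply/eqP; rewrite -[_ == _]negbK p0.
Qed.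

Lemma singular_pointP F p : F \is 3.-homog -> p != 0 ->
  singular_point F p <-> p *m hess F p = 0.
Proof.
move=> hF p0; rewrite /singular_point /singular_at_origin /local_equation.
have := chart_at_neq0 p0; set i := chart_at p => pi.
rewrite meval_affine_equation //; set q := _^-1 *: p.
have qi : q 0 i = 1 by rewrite mxE mulVf.
have -> : p *m hess F p = 0 <-> forall j, (F^`M(j)).@[q 0] = 0.
  have def_p : p = p 0 i *: q by rewrite scalerA mulfV ?scale1r.
  rewrite def_p hess_cubicZ // -scalemxAl -scalemxAr scalerA; split.
    move=> /eqP; rewrite scaler_eq0 mulf_eq0 (negbTE pi) /= => /eqP qH j.
    have /eqP := mulmx_hess_cubic q j hF.
    by rewrite qH mxE eq_sym mulf_eq0 pnatr_eq0 => /eqP.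
  move=> dF; apply/rowP => j; rewrite mxE mulmx_hess_cubic // dF.
  by rewrite !mulr0 mxE.
have euler := euler_meval (q 0) hF; split=> [[_ [F0 dF]] j|dF].
  have dF' k : (F^`M(lift i k)).@[q 0] = 0.
    by rewrite -(dF k) mderiv_affine_equation meval_affine_equation.
  case: (unliftP i j) => [k ->//|->].
  move: euler; rewrite F0 mulr0 (bigD1 i) //= qi mul1r big1 ?addr0 // => k.
  by case: (unliftP i k) => [l ->|->]; rewrite ?eqxx // dF' mulr0.
split=> //; split=> [|j].
  move: euler; rewrite big1 => [/eqP|k _]; last by rewrite dF mulr0.
  by rewrite eq_sym mulf_eq0 pnatr_eq0 => /eqP.
by rewrite mderiv_affine_equation meval_affine_equation.
Qed.

Lemma point_corank_cubic F p : F \is 3.-homog -> p != 0 ->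
  p *m hess F p = 0 -> point_corank F p = (n - \rank (hess F p))%N.
Proof.
move=> hF p0 pH; rewrite /point_corank /corank_at_origin /local_equation.
have pi := chart_at_neq0 p0; rewrite hessian_affine_equation // hess_cubicZ //.
rewrite (@mxrank_sym_minor _ _ _ p) ?linearZ /= ?hess_sym //.
  by rewrite mxrank_scale_nz ?invr_eq0.
by rewrite pH scaler0.
Qed.

End LocalEquation.

Section CorankU6.
Variable K : numFieldType.

Lemma type_U6_corank (F : {mpoly K[6]}) : F \is 3.-homog ->
  type_U6 F <->
  exists p : 'rV[K]_6, singular_point F p /\ (4 <= point_corank F p)%N.
Proof.
move=> hF; rewrite type_U6P //; split=> [[A Au [c def_H]]|[p [sp cp]]].
  have ATu : A^T \in unitmx by rewrite unitmx_tr.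
  set p := row 0 A^T in def_H.
  have p0 : p != 0.
    apply: contraTneq Au => p0; rewrite -unitmx_tr -row_free_unit.
    apply/negP => /row_free_inj inj.
    have : delta_mx 0 0 = 0 :> 'rV[K]_6 by apply: inj; rewrite -rowE -/p p0 mul0mx.
    by move/rowP/(_ 0)/eqP; rewrite !mxE oner_eq0.
  have pH : p *m hess F p = 0.
    apply: (can_inj (mulmxK Au)); rewrite mul0mx {1}/p rowE -!mulmxA [A^T *m _]mulmxA.
    rewrite def_H -scalemxAr mul_delta_mx_cond /= mulr0n.
    by rewrite scaler0.
  exists p; split; first exact/singular_pointP.
  rewrite point_corank_cubic //.
  have -> : \rank (hess F p) = \rank (A^T *m hess F p *m A).
    by rewrite mxrankMfree ?row_free_unit // -[RHS]mxrank_tr trmx_mul trmxK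
       mxrankMfree ?row_free_unit // mxrank_tr.
  rewrite def_H; have := mxrank_scale c (delta_mx ord_max ord_max : 'M[K]_6).
  by rewrite mxrank_delta; case: (\rank _) => [|[]].
have p0 := sp.1; have /singular_pointP pH := sp.
have {}pH := pH hF p0; rewrite point_corank_cubic // in cp.
have rH : (\rank (hess F p) <= 1)%N by lia.
have [A Au [Ap def_H]] := sym_rank1_normal_form (hess_sym F p) rH p0 pH.
by exists A => //; rewrite Ap.
Qed.

End CorankU6.

Section Cones.
Variable K : numFieldType.

Lemma lin_substM (n : nat) (A B : 'M[K]_n) (F : {mpoly K[n]}) :
  lin_subst B (lin_subst A F) = lin_subst (A *m B) F.
Proof.
rewrite /lin_subst comp_mpolyA; congr (_ \mPo _); apply: eq_from_tnth => i.
rewrite !tnth_mktuple raddf_sum /=.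
under eq_bigr => j _ do
  rewrite comp_mpolyZ comp_mpolyXU -tnth_nth tnth_mktuple scaler_sumr.
rewrite exchange_big; apply: eq_bigr => k _ /=.
by rewrite mxE scaler_suml; apply: eq_bigr => j _; rewrite scalerA.
Qed.

Lemma lin_subst_diag (n : nat) (d : 'rV[K]_n) (F : {mpoly K[n]}) :
  lin_subst (diag_mx d) F = F \mPo [tuple d 0 i *: 'X_i | i < n].
Proof.
congr (_ \mPo _); apply: eq_from_tnth => i; rewrite !tnth_mktuple.
rewrite (bigD1 i) //= big1 ?addr0 => [|j ne_ji]; first by rewrite mxE eqxx.
by rewrite mxE eq_sym (negbTE ne_ji) scale0r.
Qed.

Lemma comp_mpoly_dhomogZ (n k d : nat) (G : {mpoly K[n]}) (c : K)
    (lq : n.-tuple {mpoly K[k]}) : G \is d.-homog ->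
  G \mPo [tuple c *: tnth lq i | i < n] = c ^+ d *: (G \mPo lq).
Proof.
move=> hG; rewrite !comp_mpolyE scaler_sumr; apply: eq_big_seq => m m_G.
rewrite scalerA mulrC -scalerA; congr (_ *: _).
under eq_bigr do rewrite tnth_mktuple exprZn.
by rewrite scaler_prod prodrXr -mdegE (dhomog_mf hG m_G).
Qed.

(* The first coordinate is not involved in a cone with vertex [1 : 0 : ... : 0],
   so it can absorb any determinant. *)
Lemma cone_diag (n d : nat) (G : {mpoly K[n]}) (a c : K) : G \is d.-homog ->
  let Gc := G \mPo [tuple 'X_(lift ord0 j) | j < n] : {mpoly K[n.+1]} in
  lin_subst (diag_mx (\row_j (if j == ord0 then a else c))) Gc = c ^+ d *: Gc.
Proof.
move=> hG /=; rewrite lin_subst_diag comp_mpolyA -comp_mpoly_dhomogZ //.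
congr (_ \mPo _); apply: eq_from_tnth => i.
by rewrite !tnth_mktuple comp_mpolyXU -tnth_nth tnth_mktuple mxE.
Qed.

Lemma det_cone_diag (n : nat) (a c : K) :
  \det (diag_mx (\row_(j < n.+1) (if j == ord0 then a else c))) = a * c ^+ n.
Proof.
rewrite det_diag big_ord_recl mxE eqxx; congr (_ * _).
by under eq_bigr do rewrite mxE /=; rewrite prodr_const card_ord.
Qed.

Lemma cone_unstable (F : {mpoly K[6]}) : F \is 3.-homog ->
  cone_over_cubic_threefold F -> unstable F.
Proof.
move=> hF [A Au [G [hG _] def_FA]] [d [P [d0 [hP inv_P] /eqP PF]]]; apply: PF.
set Gc := G \mPo _ in def_FA.
have hGc : Gc \is 3.-homog by rewrite -def_FA lin_subst_homog.
pose D a c : 'M[K]_6 := diag_mx (\row_j (if j == ord0 then a else c)).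
have detA0 : \det A != 0 by rewrite -unitfE -unitmxE.
have <- : P.@[cubic_coords Gc] = P.@[cubic_coords F].
  rewrite -(inv_P (A *m D (\det A)^-1 1) F) //; last first.
    by rewrite det_mulmx det_cone_diag expr1n mulr1 mulfV.
  by rewrite -lin_substM def_FA (cone_diag _ _ hG) expr1n scale1r.
have two_neq0 : 2%:R != 0 :> K by rewrite pnatr_eq0.
have := inv_P (D (2 ^- 5) 2) Gc; rewrite det_cone_diag mulVf ?expf_neq0 //.
move=> /(_ erefl hGc); rewrite (cone_diag _ _ hG).
have -> : P.@[cubic_coords (2 ^+ 3 *: Gc)] = (2 ^+ 3) ^+ d * P.@[cubic_coords Gc].
  rewrite -(dhomog_mevalZ _ _ hP); apply: meval_eq => k.
  by rewrite /cubic_coords mcoeffZ.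
move/eqP; rewrite -subr_eq0 -{2}[P.@[_]]mul1r -mulrBl mulf_eq0 subr_eq0.
rewrite -natrX -natrX pnatr_eq1 => /orP[|/eqP //].
by rewrite -expnM (@eqn_exp2l 2 _ 0) //; lia.
Qed.

End Cones.

Local Open Scope complex_scope.

Theorem lemma3p9 (R : realType) :
  [/\ (forall F : {mpoly R[i][6]}, cubic_fourfold F -> type_U6 F ->
         exists p : 'rV[R[i]]_6,
           singular_point F p /\ (4 <= point_corank F p)%N),
      (forall F : {mpoly R[i][6]}, cubic_fourfold F ->
         (exists p : 'rV[R[i]]_6,
           singular_point F p /\ (4 <= point_corank F p)%N) ->
         type_U6 F)
    & (forall F : {mpoly R[i][6]}, cubic_fourfold F ->
         cone_over_cubic_threefold F -> unstable F)].
Proof.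
split=> F [hF _].
- by move/(type_U6_corank hF).
- by move=> H; apply/(type_U6_corank hF).
- exact: cone_unstable.
Qed.
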